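(* Let $E$ and $F$ be Banach spaces. If the pair $(E,F)$ has the James property, then (i) $(\mathcal{L}(E,F),\|\cdot\|)^*\neq(\mathcal{L}(E,F),\tau_c)^*$; (ii) $\mathcal{L}(E,F)$ is non-reflexive.
   Context: All Banach spaces are over a fixed field $\mathbb{K}$, which is either $\mathbb{R}$ or $\mathbb{C}$. $\mathcal{L}(E,F)$ is the Banach space of all bounded linear operators from $E$ into $F$ with the operator norm $\|\cdot\|$. The topology $\tau_c$ on $\mathcal{L}(E,F)$ is the topology of uniform convergence on compact subsets of $E$. $(\mathcal{L}(E,F),\tau)^*$ is the set of all $\tau$-continuous linear functionals on $\mathcal{L}(E,F)$. The weak operator topology (WOT) on $\mathcal{L}(E,F)$ is the topology in which a net $(T_\alpha)$ converges to $T$ if and only if $y^*(T_\alpha(x))\to y^*(T(x))$ for all $x\in E$ and $y^*\in F^*$. James property: a pair $(E,F)$ of Banach spaces has the James property if there exists a relatively WOT-compact set $K\subseteq\mathcal{L}(E,F)$ (i.e. the WOT-closure of $K$ in $\mathcal{L}(E,F)$ is WOT-compact) such that $0\in\overline{K}^{WOT}$ and $0\notin\overline{\operatorname{co}}^{\|\cdot\|}(K)$, where $\overline{\operatorname{co}}^{\|\cdot\|}(K)$ is the norm-closed convex hull of $K$. *)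

(* Defs.v *)
From HB Require Import structures.
From mathcomp Require Import all_boot all_order all_algebra.
From mathcomp Require Import all_classical all_reals all_analysis.
From mathcomp Require Import complex.

Set Implicit Arguments.
Unset Strict Implicit.
Unset Printing Implicit Defensive.

Import Order.TTheory GRing.Theory Num.Theory.
Import numFieldNormedType.Exports.

Local Open Scope classical_set_scope.
Local Open Scope ring_scope.

Variant scalar_kind := RealScalars | ComplexScalars.

Definition scalars (R : realType) (k : scalar_kind) : numFieldType :=
  match k with
  | RealScalars => R
  | ComplexScalars => R[i]%C
  end.

(* MathComp norms on a K-module take their values in K: these two maps go back
   and forth between K and R, so that suprema can be taken in R. *)
Definition scalar_re (R : realType) (k : scalar_kind) : scalars R k -> R :=
  match k with
  | RealScalars => fun x : R => x
  | ComplexScalars => fun x : R[i]%C => complex.Re x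
  end.

Definition scalar_inj (R : realType) (k : scalar_kind) : R -> scalars R k :=
  match k with
  | RealScalars => fun x : R => x
  | ComplexScalars => fun x : R => Complex x 0
  end.

Lemma scalar_re_nneg (R : realType) (k : scalar_kind) (x : scalars R k) :
  0 <= x -> scalar_inj k (scalar_re x) = x.
Proof.
by case: k x => //= -[a b]; rewrite lecE /= => /andP[/eqP -> _].
Qed.

Lemma scalar_reD (R : realType) (k : scalar_kind) :
  {morph @scalar_re R k : x y / x + y}.
Proof. by case: k => //= -[a b] [c d]. Qed.

Lemma scalar_injD (R : realType) (k : scalar_kind) :
  {morph @scalar_inj R k : x y / x + y}.
Proof. by case: k => //= a b; apply/eqP; rewrite eq_complex /= addr0 !eqxx. Qed.

Lemma scalar_injM (R : realType) (k : scalar_kind) :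
  {morph @scalar_inj R k : x y / x * y}.
Proof.
by case: k => //= a b; apply/eqP; rewrite eq_complex /=
  !(mulr0, mul0r, subr0, addr0) !eqxx.
Qed.

Lemma scalar_inj_le (R : realType) (k : scalar_kind) (x y : R) :
  (scalar_inj k x <= scalar_inj k y) = (x <= y).
Proof. by case: k => //=; rewrite lecE /= eqxx. Qed.

Lemma scalar_injK (R : realType) (k : scalar_kind) :
  cancel (@scalar_inj R k) (@scalar_re R k).
Proof. by case: k. Qed.

Lemma scalar_inj0 (R : realType) (k : scalar_kind) :
  scalar_inj k (0 : R) = 0.
Proof. by case: k. Qed.

Lemma scalar_re_le (R : realType) (k : scalar_kind) (x y : scalars R k) :
  x <= y -> scalar_re x <= scalar_re y.
Proof.
by case: k x y => //= -[a b] [c d]; rewrite lecE /= => /andP[].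
Qed.

Section bounded_operators.
Context {K : numFieldType} (E F : normedModType K).

Definition bounded_linear : {pred E -> F} := [pred f : E -> F |
  `[< linear f /\ exists M : K, forall x, `|f x| <= M * `|x| >]].

Record bounded_operator : Type := BoundedOperator {
  operator_fun :> E -> F;
  operatorP : operator_fun \in bounded_linear
}.

HB.instance Definition _ := [isSub for operator_fun].
HB.instance Definition _ := [Choice of bounded_operator by <:].

Let bounded_linear_submod : submod_closed bounded_linear.
Proof.
split.
  apply/asboolP; split; first by move=> a x y; rewrite /= scaler0 addr0.
  by exists 0 => x; rewrite mul0r normr0.
move=> a f g /asboolP[lf [M hM]] /asboolP[lg [N hN]]; apply/asboolP; split.
  move=> b x y; rewrite !fctE lf lg !scalerDr !scalerA (mulrC a b).
  by rewrite addrACA.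
exists (`|a| * M + N) => x; rewrite !fctE mulrDl.
apply: le_trans (ler_normD _ _) _; apply: lerD => //.
by rewrite normrZ -mulrA ler_wpM2l.
Qed.

HB.instance Definition _ :=
  GRing.isSubmodClosed.Build K (E -> F) bounded_linear bounded_linear_submod.
HB.instance Definition _ := [SubChoice_isSubLmodule of bounded_operator by <:].

Lemma operator_linear (T : bounded_operator) : linear T.
Proof. by have /asboolP[] := operatorP T. Qed.

HB.instance Definition _ (T : bounded_operator) :=
  GRing.isLinear.Build K E F _ (T : E -> F) (operator_linear T).

Lemma operator_bounded (T : bounded_operator) :
  exists M : K, forall x, `|T x| <= M * `|x|.
Proof. by have /asboolP[] := operatorP T. Qed.

End bounded_operators.

Notation "''L' ( E , F )" := (bounded_operator E F)
  (at level 8, format "''L' ( E ,  F )") : type_scope.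

Section operator_norm.
Context {R : realType} {k : scalar_kind}.
Local Notation K := (scalars R k).
Context {E F : normedModType K}.
Implicit Types T : 'L(E, F).

Definition operator_norm T : K :=
  scalar_inj k (sup [set scalar_re `|T x| | x in [set x : E | `|x| <= 1]]).

Let values T := [set scalar_re `|T x| | x in [set x : E | `|x| <= 1]].

Let values_has_sup T : has_sup (values T).
Proof.
split; first by exists (scalar_re `|T 0|), 0 => //=; rewrite normr0.
have [M hM] := operator_bounded T; exists (scalar_re `|M|) => _ [x /= x1 <-].
apply: scalar_re_le; apply: le_trans (hM x) _.
have: `|M * `|x| | <= `|M| by rewrite normrM normr_id ler_piMr.
by apply: le_trans; rewrite ger0_norm //; exact: le_trans (hM x).
Qed.

Lemma operator_norm_ge0 T : 0 <= operator_norm T.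
Proof.
rewrite -(scalar_inj0 R k) scalar_inj_le.
apply: sup_upper_bound; first exact: values_has_sup.
exists 0 => /=; first by rewrite normr0.
by rewrite linear0 normr0 -(scalar_inj0 R k) scalar_injK.
Qed.

Lemma le_operator_norm T x : `|T x| <= operator_norm T * `|x|.
Proof.
have [->|x0] := eqVneq x 0; first by rewrite linear0 !normr0 mulr0.
have nx0 : 0 < `|x| by rewrite normr_gt0.
rewrite -ler_pdivrMr // mulrC -[X in X * _]ger0_norm ?invr_ge0 //.
rewrite -normrZ -linearZ -[leLHS]scalar_re_nneg // scalar_inj_le.
apply: sup_upper_bound; first exact: values_has_sup.
by exists (`|x|^-1 *: x) => //=; rewrite normrZ normfV normr_id mulVf ?gt_eqF.
Qed.

Lemma operator_norm_le T (M : R) :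
  (forall x, `|x| <= 1 -> `|T x| <= scalar_inj k M) ->
  operator_norm T <= scalar_inj k M.
Proof.
move=> hM; rewrite scalar_inj_le; apply: ge_sup.
  by have [] := values_has_sup T.
by move=> _ [x /= x1 <-]; rewrite -(@scalar_injK R k M) scalar_re_le // hM.
Qed.

Let operator_norm_re T :
  operator_norm T = scalar_inj k (scalar_re (operator_norm T)).
Proof. by rewrite scalar_re_nneg // operator_norm_ge0. Qed.

Let operator_normD T U :
  operator_norm (T + U) <= operator_norm T + operator_norm U.
Proof.
rewrite (operator_norm_re T) (operator_norm_re U) -scalar_injD.
apply: operator_norm_le => x x1; rewrite scalar_injD -!operator_norm_re.
apply: le_trans (ler_normD _ _) _.
by apply: lerD; apply: le_trans (le_operator_norm _ _) _;
  rewrite ler_piMr // operator_norm_ge0.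
Qed.

Let operator_normZ_le (a : K) T :
  operator_norm (a *: T) <= `|a| * operator_norm T.
Proof.
rewrite (operator_norm_re T) -[`|a|]scalar_re_nneg // -scalar_injM.
apply: operator_norm_le => x x1.
rewrite scalar_injM -operator_norm_re scalar_re_nneg // normrZ ler_wpM2l //.
by apply: le_trans (le_operator_norm _ _) _; rewrite ler_piMr // operator_norm_ge0.
Qed.

Let operator_norm_eq0 T : operator_norm T = 0 -> T = 0.
Proof.
move=> T0; apply/val_inj/funext => x /=.
by apply/eqP; rewrite -normr_le0 -(mul0r `|x|) -T0 le_operator_norm.
Qed.

Let operator_normZ (a : K) T : operator_norm (a *: T) = `|a| * operator_norm T.
Proof.
apply/eqP; rewrite eq_le operator_normZ_le /=.
have [->|a0] := eqVneq a 0; first by rewrite normr0 mul0r operator_norm_ge0.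
rewrite -ler_pdivlMl ?normr_gt0 // -normfV.
by rewrite -{1}[T](scalerK a0) operator_normZ_le.
Qed.

HB.instance Definition _ := Lmodule_isNormed.Build K 'L(E, F)
  operator_normD operator_normZ operator_norm_eq0.

End operator_norm.

Section dual.
Context {R : realType} {k : scalar_kind}.
Local Notation K := (scalars R k).

Definition dual (V : normedModType K) : normedModType K := 'L(V, K^o).

(* Surjectivity of the canonical embedding of V into its bidual. *)
Definition reflexive_space (V : normedModType K) : Prop :=
  forall phi : dual (dual V), exists v : V, forall f : dual V, phi f = f v.

End dual.

Section operator_topologies.
Context {R : realType} {k : scalar_kind}.
Local Notation K := (scalars R k).
Variables E F : normedModType K.

Definition tau_c : topologicalType :=
  @initial_topology 'L(E, F) {family compact, E -> F} (fun T => T : E -> F).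

(* Initial topology of the maps T |-> y (T x), for x in E and y in dual F. *)
Definition WOT : topologicalType :=
  @initial_topology 'L(E, F) {ptws E * dual F -> K^o} (fun T p => p.2 (T p.1)).

Definition continuous_functional (T : topologicalType) (phi : T -> K^o) : Prop :=
  continuous phi.

Definition norm_dual : set {linear 'L(E, F) -> K^o} :=
  [set phi : {linear 'L(E, F) -> K^o} | @continuous_functional 'L(E, F) phi].

Definition tau_c_dual : set {linear 'L(E, F) -> K^o} :=
  [set phi : {linear 'L(E, F) -> K^o} | @continuous_functional tau_c phi].

Definition convex_hull (V : lmodType K) (A : set V) : set V :=
  smallest (@convex_set K V) A.

Definition relatively_WOT_compact (A : set 'L(E, F)) : Prop :=
  @compact WOT (@closure WOT A).

Definition james_property : Prop :=
  exists A : set 'L(E, F),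
    [/\ relatively_WOT_compact A,
        @closure WOT A 0 &
        ~ @closure 'L(E, F) (convex_hull A) 0].

End operator_topologies.

Arguments tau_c {R k} E F.
Arguments WOT {R k} E F.
Arguments norm_dual {R k} E F.
Arguments tau_c_dual {R k} E F.
Arguments james_property {R k} E F.

(* Main.v *)
(* A WOT-relatively compact set A is norm bounded, by the uniform boundedness
   principle applied in the dual of F and then in E.  Hahn-Banach gives a
   norm-continuous functional phi and d > 0 with d <= Re phi on co(A).

   (i) If phi were tau_c-continuous, then, because tau_c is the strong operator
   topology on bounded sets, |phi T| < d for every T in co(A) that is small
   enough on some finite subset {x_1, ..., x_n} of E.  Such T exist: 0 is in the
   weak closure of {(T x_1, ..., T x_n) | T in A}, so by Mazur it is in the norm
   closure of the convex hull.

   (ii) Let g be a Banach limit along the WOT-neighbourhoods of 0 in A.  It is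
   an element of the bidual that vanishes on T |-> y (T x), so by reflexivity
   it is evaluation at the operator 0; yet it is at least d at phi. *)
From HB Require Import structures.
Require Import Defs.
From mathcomp Require Import all_boot all_order all_algebra.
From mathcomp Require Import all_classical all_reals all_analysis.
From mathcomp Require Import complex ring lra.

Set Implicit Arguments.
Unset Strict Implicit.
Unset Printing Implicit Defensive.

Import Order.TTheory GRing.Theory Num.Theory.
Import numFieldNormedType.Exports.

Local Open Scope classical_set_scope.
Local Open Scope ring_scope.

(** * Real Hahn-Banach and Mazur-Orlicz theorems for sublinear functionals *)

Section hahn_banach.
Context {R : realType} {V : lmodType R}.
Implicit Types (p q : V -> R) (C : set V).

(** Homogeneity is asked only as an inequality for positive scalars; applying it to [a] and [a^-1]
    recovers the equality. *)
Definition sublinear p : Prop :=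
  (forall x y, p (x + y) <= p x + p y) /\
  (forall a x, 0 < a -> p (a *: x) <= a * p x).

Lemma sublinear0 p : sublinear p -> p 0 = 0.
Proof.
(* The factor [2] gives [0 <= p 0], and the factor [2^-1] gives [p 0 <= 0]. *)
move=> [_ pZ]; have := pZ 2 0 (ltr0Sn _ _); have := pZ 2^-1 0.
by rewrite !scaler0 invr_gt0 => /(_ (ltr0Sn _ _)); lra.
Qed.

Lemma sublinearZ p a x : sublinear p -> 0 <= a -> p (a *: x) = a * p x.
Proof.
move=> sp; have [_ pZ] := sp; rewrite le_eqVlt => /orP[/eqP <-|a0].
  by rewrite scale0r mul0r sublinear0.
apply/eqP; rewrite eq_le pZ //= -ler_pdivlMl //.
by apply: le_trans (pZ _ _ _); rewrite ?invr_gt0 // scalerA mulVf ?scale1r ?gt_eqF.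
Qed.

Lemma sublinearN_ge p x : sublinear p -> - p (- x) <= p x.
Proof.
by move=> sp; have := sp.1 x (- x); rewrite subrr sublinear0 //; lra.
Qed.

(** Every sublinear functional built by an infimum comes from here: [L x] collects upper values at
    [x], and [l] guarantees that the infimum is finite. *)
Lemma sublinear_inf (L : V -> set R) (l : V -> R) :
  (forall x, L x !=set0) -> (forall x, lbound (L x) (l x)) ->
  (forall x y b c, L x b -> L y c -> L (x + y) (b + c)) ->
  (forall a x b, 0 < a -> L x b -> L (a *: x) (a * b)) ->
  sublinear (fun x => inf (L x)).
Proof.
move=> L0 Ll LD LZ.
have Li x : has_inf (L x) by split => //; exists (l x); exact: Ll.
split=> [x y|a x a0].
  apply/ler_addgt0Pr => e e0.
  have e20 : 0 < e / 2 by rewrite divr_gt0.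
  have [b Lb be] := inf_adherent e20 (Li x).
  have [c Lc ce] := inf_adherent e20 (Li y).
  have := ge_inf (Li (x + y)).2 (LD _ _ _ _ Lb Lc); lra.
rewrite -ler_pdivrMl //; apply: lb_le_inf => // b Lb.
by rewrite ler_pdivrMl //; apply: ge_inf (Li _).2 _ (LZ _ _ _ a0 Lb).
Qed.

Definition convex C : Prop := forall x y t, C x -> C y ->
  0 <= t -> t <= 1 -> C (t *: x + (1 - t) *: y).

(** Normalise the weights by [s + t]; if that sum is zero, both weights vanish and any point of [C]
    serves. *)
Lemma convex_cone C x y s t : convex C -> C x -> C y -> 0 <= s -> 0 <= t ->
  exists2 z, C z & s *: x + t *: y = (s + t) *: z.
Proof.
move=> cC Cx Cy s0 t0; have [st0|st0] := eqVneq (s + t) 0.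
  have [-> ->] : s = 0 /\ t = 0 by split; lra.
  by exists x; rewrite // addr0 !scale0r addr0.
have stp : 0 < s + t by rewrite lt_neqAle eq_sym st0 addr_ge0.
exists (s / (s + t) *: x + (1 - s / (s + t)) *: y).
  apply: cC => //; first by rewrite divr_ge0 // addr_ge0.
  by rewrite ler_pdivrMr // mul1r lerDl.
rewrite scalerDr !scalerA; congr (_ *: _ + _ *: _); field => //.
Qed.

(* The infimum of [q (x + t c) - t d] over [c] in [C] and [t >= 0] is
   sublinear, below [q], and at most [- d] at [- c]. *)
Lemma sublinear_below q C d : sublinear q -> convex C -> C !=set0 ->
  (forall c, C c -> d <= q c) ->
  exists r, [/\ sublinear r, (forall x, r x <= q x) &
    (forall c, C c -> r (- c) <= - d)].
Proof.
move=> sq cC [c0 Cc0] Cd; have [qD qZ] := sq.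
pose L x := [set b | exists t c, [/\ 0 <= t, C c & q (x + t *: c) - t * d <= b]].
(* Here [t * d <= q (t *: c) <= q (x + t *: c) + q (- x)]. *)
have Llb x : lbound (L x) (- q (- x)).
  move=> b [t [c [t0 Cc]]]; apply: le_trans.
  have := qD (x + t *: c) (- x); rewrite addrAC subrr add0r sublinearZ //.
  have := ler_wpM2l t0 (Cd _ Cc); lra.
have Lhas x : has_lbound (L x) by exists (- q (- x)).
have Lq x : L x (q x).
  by exists 0, c0; split; rewrite // scale0r addr0 mul0r subr0.
exists (fun x => inf (L x)); split.
- apply: sublinear_inf Llb _ _ => [x|x y b b'|a x b a0].
  + by exists (q x).
  + move=> [t [c [t0 Cc tc]]] [s [c' [s0 Cc' sc]]].
    have [e Ce eE] := convex_cone cC Cc Cc' t0 s0.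
    exists (t + s), e; split; rewrite ?addr_ge0 // -eE addrACA mulrDl.
    have := qD (x + t *: c) (y + s *: c'); lra.
  + move=> [t [c [t0 Cc tc]]]; exists (a * t), c; split => //.
      by rewrite mulr_ge0 // ltW.
    rewrite -scalerA -scalerDr sublinearZ ?(ltW a0) // -mulrA -mulrBr.
    by rewrite ler_pM2l.
- by move=> x; apply: ge_inf (Lhas x) _ (Lq x).
- move=> c Cc; apply: ge_inf (Lhas _) _ _; exists 1, c; split => //.
  by rewrite scale1r addNr sublinear0 // mul1r sub0r.
Qed.

(** Lower bounds of chains, for Zorn's lemma. Subadditivity of the infimum uses comparability: of
    two members, the smaller one controls both values. *)
Lemma sublinear_chain_inf p (A : set (V -> R)) : sublinear p ->
  A !=set0 -> (forall q, A q -> sublinear q /\ forall x, q x <= p x) ->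
  (forall q r, A q -> A r ->
    (forall x, q x <= r x) \/ (forall x, r x <= q x)) ->
  exists q, [/\ sublinear q, (forall x, q x <= p x) &
    forall r, A r -> forall x, q x <= r x].
Proof.
move=> sp [q0 Aq0] Ap Atot.
pose L x := [set b | exists2 q, A q & q x <= b].
have Llb x : lbound (L x) (- p (- x)).
  move=> b [q /Ap[sq qp]]; apply: le_trans.
  by apply: le_trans (sublinearN_ge _ sq); rewrite lerN2.
have Lhas x : has_lbound (L x) by exists (- p (- x)).
have qL q x : A q -> inf (L x) <= q x.
  by move=> Aq; apply: ge_inf (Lhas x) _ _; exists q.
exists (fun x => inf (L x)); split => [|x|q Aq x]; last exact: qL.
  apply: sublinear_inf Llb _ _ => [x|x y b c [q Aq qb] [r Ar rc]|a x b a0].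
  - by exists (q0 x), q0.
  - have [qr|rq] := Atot _ _ Aq Ar; [exists q|exists r] => //.
      apply: le_trans ((Ap _ Aq).1.1 _ _) _; apply: lerD => //.
      by apply: le_trans rc.
    by apply: le_trans ((Ap _ Ar).1.1 _ _) _; apply: lerD => //; apply: le_trans qb.
  - move=> [q Aq qb]; exists q => //; rewrite sublinearZ ?(ltW a0) //.
      by rewrite ler_pM2l.
    exact: (Ap _ Aq).1.
by apply: le_trans (qL _ _ Aq0) _; exact: (Ap _ Aq0).2.
Qed.

(* A minimal sublinear functional is linear: [sublinear_below] at [C = [set c]]
   cannot go strictly below it. *)
Theorem hahn_banach p : sublinear p ->
  exists g : V -> R, [/\ forall x y, g (x + y) = g x + g y,
    forall a x, g (a *: x) = a * g x & forall x, g x <= p x].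
Proof.
move=> sp; pose T := {q : V -> R | sublinear q /\ forall x, q x <= p x}.
(* The order is reversed, so that a maximal element for Zorn is pointwise minimal. *)
pose below (q r : T) := `[< forall x, sval r x <= sval q x >].
have [||||[g [sg gp]] gmin] := @Zorn T below.
- by move=> q; exact/asboolP.
- move=> q r s /asboolP rq /asboolP sr; apply/asboolP => x.
  exact: le_trans (sr x) (rq x).
- move=> [q qP] [r rP] /asboolP /= rq /asboolP /= qr; apply: eq_exist.
  by apply/funext => x; apply/eqP; rewrite eq_le qr rq.
- move=> A Atot; have [->|/set0P[q0 Aq0]] := eqVneq A set0.
    have pP : sublinear p /\ forall x, p x <= p x by split.
    by exists (exist _ p pP).
  have [||q r|q [sq qp qA]] :=
    sublinear_chain_inf (A := [set sval q | q in A]) sp.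
  + by exists (sval q0), q0.
  + by move=> _ [[q qP] _ <-].
  + move=> [q' Aq' <-] [r' Ar' <-].
    by have [/asboolP|/asboolP] := Atot _ _ Aq' Ar'; [right|left].
  exists (exist _ q (conj sq qp)) => s As; apply/asboolP => x /=.
  by apply: qA; exists s.
have gD x y : g (x + y) = g x + g y.
  apply/eqP; rewrite eq_le sg.1 /=.
  have cx : convex [set x].
    by move=> _ _ t -> -> t0 t1; rewrite -scalerDl subrKC scale1r.
  have [|c ->|r [sr rg rx]] := sublinear_below (d := g x) sg cx.
  + by exists x.
  + by [].
  have rp z : r z <= p z by exact: le_trans (rg z) (gp z).
  have [rE] : exist _ r (conj sr rp) = exist _ g (conj sg gp) :> T.
    by apply: gmin; apply/asboolP.
  (* Since [r = g], [g (- x) <= - g x], and therefore [g y <= g (x + y) - g x]. *)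
  have := sr.1 (x + y) (- x); rewrite rE addrAC subrr add0r.
  by have := rx x erefl; rewrite rE; lra.
exists g; split => // a x.
have gN z : g (- z) = - g z.
  by have := gD z (- z); rewrite subrr (sublinear0 sg); lra.
have [a0|a0] := leP 0 a; first exact: sublinearZ.
rewrite -[a]opprK scaleNr gN sublinearZ ?mulNr //; lra.
Qed.

(** A linear functional below the one of [sublinear_below] is at most [- d] at [- c], hence at least
    [d] at [c]. All separation arguments reduce to this. *)
Theorem mazur_orlicz p C d : sublinear p -> convex C -> C !=set0 ->
  (forall c, C c -> d <= p c) ->
  exists g : V -> R, [/\ forall x y, g (x + y) = g x + g y,
    forall a x, g (a *: x) = a * g x, forall x, g x <= p x &
    forall c, C c -> d <= g c].
Proof.
move=> sp cC C0 Cd; have [q [sq qp qC]] := sublinear_below sp cC C0 Cd.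
have [g [gD gZ gq]] := hahn_banach sq; exists g; split => // [x|c Cc].
  exact: le_trans (gq x) (qp x).
have := le_trans (gq (- c)) (qC _ Cc).
by rewrite -scaleN1r gZ mulN1r lerN2.
Qed.

End hahn_banach.

(** * Scalars, real parts and phases *)

Lemma scalar_phase (K : numFieldType) (z : K) :
  exists2 w, `|w| = 1 & w * z = `|z|.
Proof.
have [->|z0] := eqVneq z 0; first by exists 1; rewrite ?mulr0 ?normr1 ?normr0.
by exists (`|z| / z); rewrite ?divfK // normrM normfV normr_id mulfV ?normr_eq0.
Qed.

Section scalar_maps.
Variables (R : realType).
Implicit Type k : scalar_kind.

Lemma scalar_inj1 k : scalar_inj k (1 : R) = 1.
Proof. by case: k. Qed.

Lemma scalar_injN k (a : R) : scalar_inj k (- a) = - scalar_inj k a.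
Proof. by case: k => //=; apply/eqP; rewrite eq_complex /= oppr0 !eqxx. Qed.

Lemma scalar_re0 k : scalar_re (0 : scalars R k) = 0.
Proof. by case: k. Qed.

Lemma scalar_reN k (x : scalars R k) : scalar_re (- x) = - scalar_re x.
Proof. by case: k x => //= -[]. Qed.

Lemma scalar_reM k a (x : scalars R k) :
  scalar_re (scalar_inj k a * x) = a * scalar_re x.
Proof. by case: k x => //= -[b c] /=; rewrite mul0r subr0. Qed.

Lemma scalar_norm_inj k (a : R) : `|scalar_inj k a| = scalar_inj k `|a|.
Proof.
have [a0|/ltW a0] := leP 0 a.
  by rewrite !ger0_norm // -(scalar_inj0 R k) scalar_inj_le.
by rewrite !ler0_norm ?scalar_injN // -(scalar_inj0 R k) scalar_inj_le.
Qed.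

Lemma normr_scalar_re k (x : scalars R k) : `|scalar_re x| <= scalar_re `|x|.
Proof.
case: k x => [//|[a b]]; rewrite /= -sqrtr_sqr.
by rewrite ler_sqrt ?lerDl ?sqr_ge0 // addr_ge0 ?sqr_ge0.
Qed.

Lemma scalar_inj_lt k (a b : R) : (scalar_inj k a < scalar_inj k b) = (a < b).
Proof.
by rewrite !lt_neqAle scalar_inj_le (inj_eq (can_inj (@scalar_injK R k))).
Qed.

(** Over the complex numbers, [f v = g v - i g (i v)] is the linear functional with real part [g];
    over the reals, [f] is [g]. *)
Lemma linear_scalar_re k (V : lmodType (scalars R k)) (g : V -> R) :
  {morph g : u v / u + v} -> (forall a v, g (scalar_inj k a *: v) = a * g v) ->
  exists2 f : V -> (scalars R k)^o, linear f & forall v, scalar_re (f v) = g v.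
Proof.
case: k V g => /= V g gD gZ; first by exists g => // a u v; rewrite gD gZ.
exists (fun v => Complex (g v) (- g ('i%C *: v))) => // a u v.
have gaZ w : g (a *: w) = complex.Re a * g w + complex.Im a * g ('i%C *: w).
  have {1}-> : a = Complex (complex.Re a) 0 + Complex (complex.Im a) 0 * 'i%C.
    case: a => x y; apply/eqP; rewrite eq_complex /=.
    by apply/andP; split; apply/eqP; ring.
  by rewrite scalerDl gD gZ -scalerA gZ.
have giiN w : g ('i%C *: ('i%C *: w)) = - g w.
  rewrite scalerA (_ : 'i%C * 'i%C = Complex (-1) 0) ?gZ ?mulN1r //.
  by apply/eqP; rewrite eq_complex /=; apply/andP; split; apply/eqP; ring.
have iaE : 'i%C *: (a *: u) = a *: ('i%C *: u) by rewrite !scalerA mulrC.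
rewrite scalerDr iaE !gD !gaZ giiN.
apply/eqP; rewrite eq_complex; case: a {gaZ iaE} => a b /=.
by apply/andP; split; apply/eqP; ring.
Qed.

End scalar_maps.

(** * Restriction of scalars to the reals, and real-valued norms *)

Section realification.
Context {R : realType} {k : scalar_kind}.
Local Notation K := (scalars R k).
Local Notation inj := (@scalar_inj R k).
Local Notation re := (@scalar_re R k).

(** A type synonym, so that the real module structure does not clash with the one over [K]. *)
Definition realified (V : lmodType K) : Type := V.

Section realified_lmodule.
Variable V : lmodType K.

HB.instance Definition _ := GRing.Zmodule.on (realified V).

Definition realified_scale (a : R) (v : realified V) : realified V :=
  inj a *: (v : V).

Let scaleA a b v :
  realified_scale a (realified_scale b v) = realified_scale (a * b) v.
Proof. by rewrite /realified_scale scalerA scalar_injM. Qed.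

Let scale1 : left_id 1 realified_scale.
Proof. by move=> v; rewrite /realified_scale scalar_inj1 scale1r. Qed.

Let scaleDr : right_distributive realified_scale +%R.
Proof. by move=> a u v; rewrite /realified_scale scalerDr. Qed.

Let scaleDl v : {morph realified_scale^~ v : a b / a + b}.
Proof. by move=> a b; rewrite /realified_scale scalar_injD scalerDl. Qed.

HB.instance Definition _ :=
  GRing.Zmodule_isLmodule.Build R (realified V) scaleA scale1 scaleDr scaleDl.

End realified_lmodule.

Lemma scalar_gt0P (e : K) : 0 < e -> exists2 a : R, 0 < a & e = inj a.
Proof.
move=> e0; have eE : inj (re e) = e by rewrite scalar_re_nneg ?ltW.
by exists (re e); rewrite // -(scalar_inj_lt k) scalar_inj0 eE.
Qed.

(** The norm of [V] moved from [K] to [R], where infima and linear arithmetic are available. *)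
Definition rnorm (V : normedModType K) (v : V) : R := re `|v|.

Section rnorm.
Variable V : normedModType K.
Implicit Types u v : V.

Lemma rnormE v : `|v| = inj (rnorm v).
Proof. by rewrite /rnorm scalar_re_nneg. Qed.

Lemma rnorm_le u (a : R) : (`|u| <= inj a) = (rnorm u <= a).
Proof. by rewrite rnormE scalar_inj_le. Qed.

Lemma rnorm_lt u (a : R) : (`|u| < inj a) = (rnorm u < a).
Proof. by rewrite rnormE scalar_inj_lt. Qed.

Lemma rnorm_ge0 v : 0 <= rnorm v.
Proof. by rewrite -(scalar_inj_le k) scalar_inj0 -rnormE. Qed.

Lemma rnormD u v : rnorm (u + v) <= rnorm u + rnorm v.
Proof. by rewrite -rnorm_le scalar_injD -!rnormE ler_normD. Qed.

Lemma rnormN v : rnorm (- v) = rnorm v.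
Proof. by rewrite /rnorm normrN. Qed.

Lemma rnormZ a v : rnorm (inj a *: v) = `|a| * rnorm v.
Proof. by rewrite /rnorm normrZ scalar_norm_inj scalar_reM. Qed.

Lemma rnorm0 : rnorm (0 : V) = 0.
Proof. by rewrite /rnorm normr0 scalar_re0. Qed.

Lemma rnorm0_eq0 v : rnorm v = 0 -> v = 0.
Proof. by move=> v0; apply/normr0_eq0; rewrite rnormE v0 scalar_inj0. Qed.

Lemma sublinear_rnorm : sublinear (@rnorm V : realified V -> R).
Proof.
split=> [u v|a u a0]; first exact: rnormD.
by rewrite [leLHS]rnormZ gtr0_norm.
Qed.

End rnorm.

Lemma rnorm_operator_le (E F : normedModType K) (T : 'L(E, F)) x :
  rnorm (T x) <= rnorm T * rnorm x.
Proof. by rewrite -rnorm_le scalar_injM -!rnormE le_operator_norm. Qed.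

(** The bound on the real part passes to [f] with the same constant: rotating [v] by a phase makes
    [f v] equal to its modulus without changing the norm of [v]. *)
Theorem complexify (V : normedModType K) (g : V -> R) (M : R) : 0 <= M ->
  {morph g : u v / u + v} -> (forall a v, g (inj a *: v) = a * g v) ->
  (forall v, g v <= M * rnorm v) ->
  exists f : dual V, (forall v, re (f v) = g v) /\ rnorm f <= M.
Proof.
move=> M0 gD gZ gM; have [f lf fre] := linear_scalar_re gD gZ.
have fM v : rnorm (f v) <= M * rnorm v.
  have [w w1 wf] := scalar_phase (f v).
  have <- : re (w * f v) = rnorm (f v) by rewrite wf.
  have -> : w * f v = f (w *: v).
    have f0 : f 0 = 0 by have := lf (-1) 0 0; rewrite scaler0 addr0 scaleN1r addNr.
    by have := lf w v 0; rewrite f0 !addr0.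
  rewrite fre; apply: le_trans (gM _) _.
  by rewrite /rnorm normrZ w1 mul1r.
have bf : f \in @bounded_linear K V K^o.
  apply/asboolP; split => //; exists (inj M) => v.
  by rewrite !rnormE -scalar_injM scalar_inj_le.
exists (BoundedOperator bf); split => //; rewrite -rnorm_le.
apply: operator_norm_le => v; rewrite -scalar_inj1 rnorm_le => v1.
by rewrite rnorm_le /=; apply: le_trans (fM v) _; rewrite ler_piMr.
Qed.

End realification.

(** * Separation from the origin and norming functionals *)

Section duality.
Context {R : realType} {k : scalar_kind}.
Local Notation K := (scalars R k).
Local Notation inj := (@scalar_inj R k).
Local Notation re := (@scalar_re R k).

(** This is [mazur_orlicz] for the norm: domination by the norm becomes the bound 1 on the dual
    norm. *)
Lemma dual_separation (V : normedModType K) (C : set V) (d : R) :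
  @convex R (realified V) C -> C !=set0 -> (forall c, C c -> d <= rnorm c) ->
  exists f : dual V, rnorm f <= 1 /\ forall c, C c -> d <= re (f c).
Proof.
move=> cC C0 Cd.
have [g [gD gZ gle gC]] := mazur_orlicz (sublinear_rnorm V) cC C0 Cd.
have [|f [fre f1]] := @complexify R k V g 1 ler01 gD gZ.
  by move=> v; rewrite mul1r gle.
by exists f; split => // c Cc; rewrite fre gC.
Qed.

Lemma norming_functional (V : normedModType K) (v : V) :
  exists f : dual V, rnorm f <= 1 /\ rnorm v <= re (f v).
Proof.
have [|||f [f1 fv]] := @dual_separation V [set v] (rnorm v).
- by move=> _ _ t -> -> t0 t1; rewrite -scalerDl subrKC scale1r.
- by exists v.
- by move=> _ ->.
by exists f; split => //; exact: fv.
Qed.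

End duality.

(** * Uniform boundedness principle for seminorms *)

Section uniform_boundedness.
Context {R : realType} {V : lmodType R} {I : Type}.
Variables (N : V -> R) (p : I -> V -> R) (M : I -> R).
Hypothesis N_ge0 : forall x, 0 <= N x.
Hypothesis NZ : forall a x, N (a *: x) = `|a| * N x.
Hypothesis pD : forall i x y, p i (x + y) <= p i x + p i y.
Hypothesis pZ : forall i a x, p i (a *: x) = `|a| * p i x.
Hypothesis pN : forall i x, p i x <= M i * N x.
(* Completeness, only as far as the seminorms [p i] can see. *)
Hypothesis complete : forall (x : nat -> V) (r : nat -> R),
  (forall n, 0 <= r n) -> (forall n, r n.+1 <= r n / 2) ->
  (forall n, N (x n.+1 - x n) <= r n / 2) ->
  exists l, forall i n, p i (l - x n) <= `|M i| * r n.

(** By homogeneity, a bound [B] on the ball of radius [e] would give the global constant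
    [|B| / e]. *)
Let large_values (e B : R) : 0 < e ->
  ~ (exists B, forall i x, p i x <= B * N x) ->
  exists i x, N x <= e /\ B < p i x.
Proof.
move=> e0 unb; apply: contrapT => small; apply: unb.
exists (`|B| / e) => i x; rewrite leNgt; apply/negP => large.
have px : p i x <= M i * N x := pN i x.
have Nx : 0 < N x.
  rewrite lt_neqAle eq_sym N_ge0 andbT; apply/eqP => Nx0.
  by move: large px; rewrite Nx0 !mulr0; lra.
apply: small; exists i, ((e / N x) *: x).
have eN : 0 <= e / N x by rewrite divr_ge0 // ltW.
rewrite NZ pZ ger0_norm // divfK ?gt_eqF //; split => //.
apply: le_lt_trans (ler_norm B) _.
rewrite mulrAC ltr_pdivlMr // -ltr_pdivrMl // mulrA [_^-1 * _]mulrC.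
exact: large.
Qed.

(** As [2 z = (x + z) - (x - z)], the two values cannot both be smaller than [p i z]. *)
Let far_value (x z : V) (i : I) :
  p i z <= p i (x + z) \/ p i z <= p i (x - z).
Proof.
have [|zx] := leP (p i z) (p i (x + z)); [by left|right].
have := pD i (x + z) (- 1 *: (x - z)).
have -> : x + z + (- 1 *: (x - z)) = 2 *: z.
  by rewrite scaleN1r opprB addrC -addrA addKr scaler_nat.
rewrite !pZ normrN1 ger0_norm //; lra.
Qed.

(** Gliding hump: the n-th step moves the point by at most half the current radius to where some
    [p i] is at least [n + 2], then shrinks the radius so that later moves change this [p i] by at
    most 1. *)
Theorem uniform_boundedness :
  (forall x, exists B, forall i, p i x <= B) ->
  exists B, forall i x, p i x <= B * N x.
Proof.
move=> ptb; apply: contrapT => unb.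
have step (s : nat * (V * {posnum R})) : exists t : V * {posnum R},
    [/\ N (t.1 - s.2.1) <= s.2.2%:num / 2, t.2%:num <= s.2.2%:num / 2 &
    exists i, s.1%:R + 2 <= p i t.1 /\ `|M i| * t.2%:num <= 1].
  case: s => n [x r] /=.
  have r20 : 0 < r%:num / 2 by rewrite divr_gt0.
  have [i [z [Nz zB]]] := large_values (n%:R + 2) r20 unb.
  have [y Ny yB] : exists2 y, N (y - x) <= r%:num / 2 & n%:R + 2 <= p i y.
    have [zx|zx] := far_value x z i; [exists (x + z)|exists (x - z)].
    + by rewrite addrAC subrr add0r.
    + by apply: le_trans zx; exact: ltW.
    + by rewrite addrAC subrr add0r -scaleN1r NZ normrN1 mul1r.
    + by apply: le_trans zx; exact: ltW.
  (* The [+ 1] keeps the inverse meaningful when [M i = 0]. *)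
  have M1 : 0 < (`|M i| + 1)^-1 by rewrite invr_gt0 ltr_wpDl.
  have m0 : 0 < Num.min (r%:num / 2) (`|M i| + 1)^-1 by rewrite lt_min r20.
  exists (y, PosNum m0); split => //=; first by rewrite ge_min lexx.
  exists i; split => //.
  apply: (@le_trans _ _ (`|M i| * (`|M i| + 1)^-1)).
    by rewrite ler_wpM2l // ge_min lexx orbT.
  by rewrite ler_pdivrMr ?ltr_wpDl // mul1r lerDl.
have [f fP] := choice step.
pose s := fix s n : V * {posnum R} :=
  if n is m.+1 then f (m, s m) else (0, PosNum ltr01).
have [|||l lP] := complete (x := fun n => (s n).1) (r := fun n => (s n).2%:num).
- by move=> n.
- by move=> n; have [] := fP (n, s n).
- by move=> n; have [] := fP (n, s n).
have [B lB] := ptb l.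
(* With [n] the integer part of [B], this [i] gives [p i l >= n + 2 - 1 > B]. *)
have [_ _ [i [pB M1]]] := fP (Num.truncn B, s (Num.truncn B)).
have := lP i (Num.truncn B).+1; have := lB i.
have := pD i l (-1 *: (l - (s (Num.truncn B).+1).1)).
rewrite pZ normrN1 mul1r scaleN1r opprB addrC subrK.
have := truncnS_gt B; rewrite -natr1 => tB.
move: pB M1; rewrite -/(s (Num.truncn B).+1) /=; lra.
Qed.

End uniform_boundedness.

(** * Limits of sequences with geometrically decreasing steps *)

Section completeness.
Context {R : realType} {k : scalar_kind}.
Local Notation K := (scalars R k).
Local Notation inj := (@scalar_inj R k).
Local Notation re := (@scalar_re R k).

Lemma geometric_limit (V : completeNormedModType K) (x : nat -> V)
    (r : nat -> R) :
  (forall n, 0 <= r n) -> (forall n, r n.+1 <= r n / 2) ->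
  (forall n, rnorm (x n.+1 - x n) <= r n / 2) ->
  exists l, x @ \oo --> l /\ forall n, rnorm (l - x n) <= r n.
Proof.
move=> r0 rr xr.
(* Each step is at most [r n / 2 <= r n - r n.+1], so the estimates telescope. *)
have xn n j : rnorm (x (n + j)%N - x n) <= r n - r (n + j)%N.
  elim: j => [|j IH]; first by rewrite addn0 !subrr rnorm0.
  rewrite addnS -(subrKA (x (n + j)%N)); apply: le_trans (rnormD _ _) _.
  have := xr (n + j)%N; have := rr (n + j)%N; lra.
have xm n m : (n <= m)%N -> rnorm (x m - x n) <= r n.
  move=> nm; have := xn n (m - n)%N; rewrite subnKC //.
  have := r0 m; lra.
have r2 n : r n <= r 0%N / 2 ^+ n.
  elim: n => [|n IH]; first by rewrite expr0 divr1.
  apply: le_trans (rr n) _; rewrite exprSr invfM mulrA.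
  by rewrite ler_pM2r ?invr_gt0.
have rlt e : 0 < e -> exists n, r n < e.
  (* For this [n], [r 0 / e < n + 1 <= 2 ^ n]. *)
  move=> e0; exists (Num.truncn (r 0%N / e)); apply: le_lt_trans (r2 _) _.
  rewrite ltr_pdivrMr ?exprn_gt0 // -ltr_pdivrMl // mulrC.
  apply: lt_le_trans (truncnS_gt _) _.
  by rewrite -natrX ler_nat ltn_expl.
have /cvg_ex[l xl] : cvg (x @ \oo).
  apply: cauchy_cvg; apply: cauchy_exP => _ /scalar_gt0P[e e0 ->].
  have [n rn] := rlt _ e0; exists (x n), n => // m /= nm.
  rewrite -ball_normE /ball_ /= rnorm_lt -rnormN opprB.
  exact: le_lt_trans (xm _ _ nm) rn.
exists l; split => // n; apply/ler_addgt0Pr => e e0.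
have ie0 : 0 < inj e by rewrite -(scalar_inj0 R k) scalar_inj_lt.
have /cvgrPdist_lt/(_ _ ie0)[m _ /(_ (maxn n m))] := xl.
rewrite /= leq_maxr rnorm_lt => /(_ isT) lm.
rewrite -(subrKA (x (maxn n m))); apply: le_trans (rnormD _ _) _.
have := xm n (maxn n m) (leq_maxl _ _); lra.
Qed.

End completeness.

(** * From pointwise bounds to norm bounds *)

Section bounded_families.
Context {R : realType} {k : scalar_kind}.
Local Notation K := (scalars R k).
Local Notation inj := (@scalar_inj R k).
Local Notation re := (@scalar_re R k).

(** Completeness of the dual as seen by evaluations: real parts converge pointwise in [R], and their
    limit is complexified. *)
Lemma dual_geometric_limit (V : normedModType K) (f : nat -> dual V)
    (r : nat -> R) :
  (forall n, 0 <= r n) -> (forall n, r n.+1 <= r n / 2) ->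
  (forall n, rnorm (f n.+1 - f n) <= r n / 2) ->
  exists l : dual V, forall n v, `|re ((l - f n) v)| <= r n * rnorm v.
Proof.
move=> r0 rr fr.
have lim v : exists l : R, (fun n => re (f n v)) @ \oo --> l /\
    forall n, `|l - re (f n v)| <= r n * rnorm v.
  apply: (@geometric_limit R RealScalars R^o (fun n => re (f n v))
    (fun n => r n * rnorm v)) => n.
  - by rewrite mulr_ge0 ?rnorm_ge0.
  - by rewrite mulrAC ler_wpM2r ?rnorm_ge0.
  - rewrite /rnorm /= -scalar_reN -scalar_reD mulrAC.
    apply: le_trans (normr_scalar_re _) _.
    apply: le_trans (rnorm_operator_le (f n.+1 - f n) v) _.
    by rewrite ler_wpM2r ?rnorm_ge0.
have [g gP] := choice lim.
have gD : {morph g : u v / u + v}.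
  move=> u v; apply: (@cvg_unique _ (@norm_hausdorff R R^o) _ _ _ _ (gP _).1).
  have -> : (fun n => re (f n (u + v))) = (fun n => re (f n u) + re (f n v)).
    by apply/funext => n; rewrite linearD scalar_reD.
  exact: cvgD (gP u).1 (gP v).1.
have gZ a v : g (inj a *: v) = a * g v.
  apply: (@cvg_unique _ (@norm_hausdorff R R^o) _ _ _ _ (gP _).1).
  have -> : (fun n => re (f n (inj a *: v))) = (fun n => a * re (f n v)).
    by apply/funext => n; rewrite linearZ -scalar_reM.
  exact: cvgM (cvg_cst a) (gP v).1.
have gle v : g v <= (rnorm (f 0%N) + r 0%N) * rnorm v.
  have := (gP v).2 0%N; have := rnorm_operator_le (f 0%N) v.
  have := normr_scalar_re (f 0%N v); rewrite /rnorm.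
  rewrite !ler_norml; lra.
have [|l [lg _]] := complexify _ gD gZ gle.
  by rewrite addr_ge0 ?rnorm_ge0.
exists l => n v.
by rewrite [(l - f n) v]/(l v - f n v) scalar_reD scalar_reN lg (gP v).2.
Qed.

(** Uniform boundedness on the dual, with the vectors of [A] acting by evaluation; a norming
    functional turns the resulting bound into one on [rnorm v]. *)
Lemma weakly_bounded (F : normedModType K) (A : set F) :
  (forall y : dual F, exists B, forall v, A v -> `|re (y v)| <= B) ->
  exists B, forall v, A v -> rnorm v <= B.
Proof.
move=> wb.
have [||||||y|B AB] := @uniform_boundedness R (realified (dual F)) {v | A v}
  (@rnorm _ _ (dual F)) (fun v y => `|re ((y : dual F) (sval v))|)
  (fun v => rnorm (sval v)).
- by move=> y; exact: rnorm_ge0.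
- by move=> a y; exact: rnormZ.
- by move=> v y z; apply: le_trans (ler_normD _ _); rewrite -scalar_reD.
- by move=> v a y; rewrite -normrM -scalar_reM.
- move=> v y; apply: le_trans (normr_scalar_re _) _; rewrite mulrC.
  exact: rnorm_operator_le.
- move=> f r r0 rr fr; have [l lP] := dual_geometric_limit r0 rr fr.
  by exists l => v n; rewrite mulrC [`|rnorm _|]ger0_norm ?rnorm_ge0.
- by have [B yB] := wb y; exists B => -[v Av]; exact: yB.
exists `|B| => v Av; have [y [y1 vy]] := norming_functional v.
apply: le_trans vy _; apply: le_trans (ler_norm _) _.
apply: le_trans (AB (exist _ v Av) y) _.
apply: le_trans (ler_norm _) _; rewrite normrM ler_piMr //.
by rewrite ger0_norm ?rnorm_ge0.
Qed.

Lemma pointwise_bounded_operators (E : completeNormedModType K)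
    (F : normedModType K) (A : set 'L(E, F)) :
  (forall x, exists B, forall T, A T -> rnorm (T x) <= B) ->
  exists2 B, 0 <= B & forall T, A T -> rnorm T <= B.
Proof.
move=> pb.
have [||||||x|B AB] := @uniform_boundedness R (realified E) {T | A T}
  (@rnorm _ _ E) (fun T x => rnorm (sval T x)) (fun T => rnorm (sval T)).
- by move=> y; exact: rnorm_ge0.
- by move=> a y; exact: rnormZ.
- move=> T x y; rewrite linearD; exact: rnormD.
- by move=> T a x; rewrite -rnormZ -linearZ.
- by move=> T x; exact: rnorm_operator_le.
- move=> x r r0 rr xr; have [l [_ lP]] := geometric_limit r0 rr xr.
  exists l => T n; apply: le_trans (rnorm_operator_le _ _) _.
  by rewrite ger0_norm ?rnorm_ge0 // ler_wpM2l ?rnorm_ge0.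
- by have [B yB] := pb x; exists B => -[T AT]; exact: yB.
exists `|B| => // T AT; rewrite -rnorm_le; apply: operator_norm_le => x.
rewrite -(scalar_inj1 R k) !rnorm_le => x1.
apply: le_trans (AB (exist _ T AT) x) _.
apply: le_trans (ler_norm _) _; rewrite normrM ler_piMr //.
by rewrite ger0_norm ?rnorm_ge0.
Qed.

End bounded_families.

(** * Convex hulls and the weak operator topology *)

Section weak_operator_topology.
Context {R : realType} {k : scalar_kind}.
Local Notation K := (scalars R k).
Local Notation inj := (@scalar_inj R k).
Local Notation re := (@scalar_re R k).

Lemma convex_hull_sub (V : lmodType K) (A : set V) : A `<=` convex_hull A.
Proof. exact: sub_smallest. Qed.

Lemma convex_hull_convex (V : lmodType K) (A : set V) :
  @convex R (realified V) (convex_hull A).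
Proof.
move=> x y t Hx Hy t0 t1 C [cC AC].
have it0 : 0 <= inj t by rewrite -(scalar_inj0 R k) scalar_inj_le.
have it1 : inj t <= 1 by rewrite -(scalar_inj1 R k) scalar_inj_le.
have /mem_set Cx := Hx _ (conj cC AC); have /mem_set Cy := Hy _ (conj cC AC).
have := cC x y (Itv01 it0 it1) Cx Cy.
rewrite inE; congr C; congr (_ + _).
by rewrite [RHS]/(inj (1 - t) *: y) scalar_injD scalar_injN scalar_inj1.
Qed.

Lemma convex_hull_min (V : lmodType K) (A C : set V) :
  @convex R (realified V) C -> A `<=` C -> convex_hull A `<=` C.
Proof.
move=> cC AC; apply: smallest_sub => // x y l; rewrite !inE => Cx Cy.
(* A weight in the unit interval of [K] is nonnegative, hence real. *)
have [t lt] : exists t, l%:num = inj t.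
  by exists (re l%:num); rewrite scalar_re_nneg.
have t0 : 0 <= t by rewrite -(scalar_inj_le k) scalar_inj0 -lt.
have t1 : t <= 1 by rewrite -(scalar_inj_le k) scalar_inj1 -lt.
have := cC x y t Cx Cy t0 t1; congr C; congr (_ + _).
  by rewrite [LHS]/(inj t *: x) -lt.
by rewrite [LHS]/(inj (1 - t) *: y) scalar_injD scalar_injN scalar_inj1 -lt.
Qed.

Lemma scalar_re_continuous : continuous (re : K^o -> R^o).
Proof.
move=> x.
apply/(@cvgrPdist_lt R R^o _ (nbhs (x : K^o)) (nbhs_filter (x : K^o))) => e e0.
have : \forall y \near (x : K^o), `|x - y| < inj e.
  by apply/nbhs_normP; exists (inj e); rewrite //= -(scalar_inj0 R k) scalar_inj_lt.
apply: (@filterS _ (nbhs (x : K^o))) => y; rewrite (@rnorm_lt _ _ K^o) /rnorm => xy.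
by rewrite -scalar_reN -scalar_reD; apply: le_lt_trans (normr_scalar_re _) _.
Qed.

Variables E F : normedModType K.

Lemma WOT_continuous (x : E) (y : dual F) :
  continuous ((fun T => re (y (T x))) : WOT E F -> R^o).
Proof.
move=> T; apply: (@continuous_comp _ _ _ (fun T : WOT E F => y (T x) : K^o) re);
  last exact: scalar_re_continuous.
have := @initial_continuous 'L(E, F) {ptws E * dual F -> K^o}
  (fun T p => p.2 (T p.1)) T.
move=> /(@continuous_comp _ _ _ _ (proj (x, y) : {ptws E * dual F -> K^o} -> _)).
by apply; exact: proj_continuous.
Qed.

Lemma WOT_near0 (x : E) (y : dual F) (e : R) : 0 < e ->
  \forall T \near ((0 : 'L(E, F)) : WOT E F), `|re (y ((T : 'L(E, F)) x))| < e.
Proof.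
pose O : WOT E F := (0 : 'L(E, F)).
move=> e0.
have /(@cvgrPdist_lt R R^o _ (nbhs O) (nbhs_filter O))/(_ _ e0) :=
  @WOT_continuous x y O.
apply: (@filterS _ (nbhs O)) => T.
by rewrite linear0 scalar_re0 sub0r normrN.
Qed.

(** The WOT-closure is compact, so its continuous image in [R] is compact and thus bounded. *)
Lemma WOT_compact_bounded (A : set 'L(E, F)) (x : E) (y : dual F) :
  relatively_WOT_compact A ->
  exists B, forall T, A T -> `|re (y (T x))| <= B.
Proof.
move=> cA.
have : compact [set re (y (T x)) | T in @closure (WOT E F) A].
  apply: (@continuous_compact (WOT E F) R^o) cA.
  exact/continuous_subspaceT/WOT_continuous.
move=> /(@compact_bounded R R^o)[M [_ MB]].
exists (M + 1) => T AT; apply: MB; first by rewrite ltrDl.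
by exists T => //; exact: subset_closure.
Qed.

End weak_operator_topology.

(** * Consequences of the James property *)

Section james.
Context {R : realType} {k : scalar_kind}.
Local Notation K := (scalars R k).
Local Notation inj := (@scalar_inj R k).
Local Notation re := (@scalar_re R k).

(** Some ball of radius [d] around 0 misses the hull, so the norm is at least [d] there and
    [dual_separation] applies. *)
Lemma hull_separation (V : normedModType K) (A : set V) : A !=set0 ->
  ~ closure (convex_hull A) 0 ->
  exists f : dual V, exists2 d, 0 < d & forall v, convex_hull A v -> d <= re (f v).
Proof.
move=> [a Aa] /existsNP[B /not_implyP[B0 AB]].
have [_ /= /scalar_gt0P[d d0 ->] dB] := (nbhs_ballP _ _).1 B0.
have [||v Hv|f [_ fd]] := @dual_separation R k V (convex_hull A) d.
- exact: convex_hull_convex.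
- by exists a; exact: convex_hull_sub.
- rewrite leNgt; apply/negP => vd; apply: AB; exists v; split => //.
  by apply: dB; rewrite -ball_normE /ball_ /= sub0r normrN rnorm_lt.
by exists f, d.
Qed.

(** The l1 norm on the finite power of [F]; [dual_coordinates] describes the functionals it
    dominates. *)
Lemma sublinear_sum_rnorm (F : normedModType K) (I : finType) :
  sublinear (fun v : I -> realified F => \sum_i rnorm (v i : F)).
Proof.
split=> [u v|a u a0].
  by rewrite -big_split; apply: ler_sum => i _; exact: rnormD.
rewrite mulr_sumr; apply: ler_sum => i _.
by rewrite [leLHS]rnormZ gtr0_norm.
Qed.

(** Split [u] into its coordinates through the insertions [e i]; each [g \o e i] is dominated by the
    norm of [F], hence is the real part of an element of the dual. *)
Lemma dual_coordinates (F : normedModType K) (I : finType)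
    (g : (I -> realified F) -> R) :
  (forall u v, g (u + v) = g u + g v) -> (forall a u, g (a *: u) = a * g u) ->
  (forall u, g u <= \sum_i rnorm (u i : F)) ->
  exists y : I -> dual F, forall u, g u = \sum_i re (y i (u i)).
Proof.
move=> gD gZ gle.
pose e i (w : realified F) : I -> realified F := fun j => if j == i then w else 0.
have eD i w z : e i (w + z) = e i w + e i z.
  by apply/funext => j; rewrite fctE /e; case: eqP; rewrite ?addr0.
have eZ i a w : e i (a *: w) = a *: e i w.
  by apply/funext => j; rewrite fctE /e; case: eqP; rewrite ?scaler0.
have /choice[y yP] i : exists y : dual F, forall w, re (y w) = g (e i w).
  have [|||y [yg _]] := @complexify R k F (g \o e i) 1 ler01; last by exists y.
  - by move=> w z /=; rewrite -gD -eD.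
  - by move=> a w /=; rewrite -gZ -eZ.
  - move=> w /=; rewrite mul1r; apply: le_trans (gle _) _.
    rewrite (bigD1 i) //= /e eqxx big1 ?addr0 // => j /negPf ->.
    exact: rnorm0.
exists y => u; under eq_bigr do rewrite yP.
have g0 : g 0 = 0 by rewrite -(scale0r 0) gZ mul0r.
have -> : u = \sum_i e i (u i).
  apply/funext => j; rewrite fct_sumE (bigD1 j) //= /e eqxx big1 ?addr0 //.
  by move=> i; rewrite eq_sym => /negPf ->.
rewrite (big_morph g gD g0); apply: eq_bigr => i _; congr (g (e i _)).
rewrite fct_sumE (bigD1 i) //= /e eqxx big1 ?addr0 //.
by move=> j; rewrite eq_sym => /negPf ->.
Qed.

Variables E F : completeNormedModType K.
Implicit Types A : set 'L(E, F).

Lemma WOT_compact_norm_bounded A : relatively_WOT_compact A ->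
  exists2 B, 0 <= B & forall T, A T -> rnorm T <= B.
Proof.
move=> cA; apply: pointwise_bounded_operators => x.
have [y|B AB] := @weakly_bounded R k F [set T x | T in A].
  have [B yB] := WOT_compact_bounded x y cA.
  by exists B => _ [T AT <-]; exact: yB.
by exists B => T AT; apply: AB; exists T.
Qed.

(* Mazur's theorem: in [F^n] the weak closure of a convex set is its norm
   closure. *)
Lemma hull_strongly_small A (s : seq E) (e : R) : 0 < e ->
  @closure (WOT E F) A (0 : 'L(E, F)) ->
  exists2 T, convex_hull A T & forall x, x \in s -> rnorm (T x) < e.
Proof.
move=> e0 A0; apply: contrapT => far.
have [T0 [AT0 _]] := A0 setT filterT.
pose ev (T : 'L(E, F)) : 'I_(size s) -> realified F := fun i => T s`_i.
have cC : convex [set ev T | T in convex_hull A].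
  move=> _ _ t [T HT <-] [U HU <-] t0 t1.
  by exists (inj t *: T + inj (1 - t) *: U) => //; exact: convex_hull_convex.
have [|_ [T HT <-]|g [gD gZ gle gC]] :=
    mazur_orlicz (d := e) (@sublinear_sum_rnorm F 'I_(size s)) cC.
- by exists (ev T0), T0 => //; exact: convex_hull_sub.
- rewrite leNgt; apply/negP => small; apply: far; exists T => // x xs.
  have xi : (index x s < size s)%N by rewrite index_mem.
  apply: le_lt_trans small; rewrite (bigD1 (Ordinal xi)) //= /ev /= nth_index //.
  by rewrite lerDl sumr_ge0 // => i _; exact: rnorm_ge0.
have [y gE] := dual_coordinates gD gZ gle.
(* The successor makes [size s] terms below [eta] sum to strictly less than [e], and covers an empty
   [s]. *)
pose eta := e / (size s).+1%:R.
have eta0 : 0 < eta by rewrite divr_gt0.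
pose O : WOT E F := (0 : 'L(E, F)).
have /filter_forall : forall i : 'I_(size s),
    \forall T \near O, `|re (y i ((T : 'L(E, F)) s`_i))| < eta.
  by move=> i; exact: WOT_near0.
move=> /A0[T [AT Ty]].
have HT := @convex_hull_sub _ _ _ _ _ AT.
have := gC _ (ex_intro2 _ _ T HT erefl); rewrite gE.
apply/negP; rewrite -ltNge.
apply: (@le_lt_trans _ _ (\sum_(i < size s) eta)).
  by apply: ler_sum => i _; apply: le_trans (ler_norm _) _; exact/ltW/Ty.
rewrite sumr_const card_ord -mulr_natr mulrAC ltr_pdivrMr // ltr_pM2l //.
by rewrite ltr_nat.
Qed.

Lemma compact_net (C : set E) (e : R) : compact C -> 0 < e ->
  exists s : seq E, forall x, C x -> exists2 z, z \in s & rnorm (x - z) < e.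
Proof.
rewrite compact_cover => cC e0.
have ie0 : 0 < inj e by rewrite -(scalar_inj0 R k) scalar_inj_lt.
have [||D _ CD] := cC E C (fun z => ball z (inj e)).
- by move=> z _; exact: ball_open.
- by move=> x Cx; exists x => //; exact: ballxx.
exists (finmap.enum_fset D) => x /CD[z /= zD].
rewrite -ball_normE /ball_ /= rnorm_lt -rnormN opprB => xz.
by exists z.
Qed.

(* On bounded sets [tau_c] is the strong operator topology. *)
Lemma tau_c_small A (B : R) (N : set (tau_c E F)) : 0 <= B ->
  (forall T, A T -> rnorm T <= B) -> nbhs ((0 : 'L(E, F)) : tau_c E F) N ->
  exists s : seq E, exists2 e, 0 < e &
    forall T, A T -> (forall x, x \in s -> rnorm (T x) < e) -> N T.
Proof.
move=> B0 AB.
pose small (q : seq E * R) : set 'L(E, F) :=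
  [set T | A T /\ forall x, x \in q.1 -> rnorm (T x) < q.2].
(* The claim says that every [tau_c]-neighbourhood of 0 lies in this filter, that is, that [G]
   converges to 0 uniformly on compact sets. *)
pose G : set_system 'L(E, F) := filter_from [set q | 0 < q.2] small.
have GF : Filter G.
  apply: filter_from_filter; first by exists ([::], 1) => /=.
  move=> [s d] [t e] /= d0 e0; exists (s ++ t, Num.min d e) => /=.
    by rewrite lt_min d0.
  by move=> T [AT sT]; split; split=> // x xs; have := sT x;
    rewrite /= mem_cat xs ?orbT => /(_ isT); rewrite lt_min => /andP[].
have G0 : (fun T : 'L(E, F) => T : E -> F) @ G -->
    ((0 : 'L(E, F)) : {family compact, E -> F}).
  apply/fam_cvgP => C cC P /uniform_nbhs[U [entU UP]].
  move: entU; rewrite -entourage_ballE => -[_ /= /scalar_gt0P[e e0 ->] eU].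
  have B1 : 0 < B + 1 by rewrite ltr_wpDl.
  have e20 : 0 < e / 2 by rewrite divr_gt0.
  (* With mesh [(e / 2) / (B + 1)], replacing [x] by a net point changes [T x] by at most [e / 2];
     the [+ 1] keeps the divisor positive. *)
  have [s sC] := compact_net cC (divr_gt0 e20 B1).
  exists (s, e / 2) => //= T [AT sT]; apply: UP => x Cx; apply: eU => /=.
  rewrite -ball_normE /ball_ /= sub0r normrN rnorm_lt.
  have [z zs xz] := sC x Cx.
  rewrite -[x](subrK z) linearD; apply: le_lt_trans (rnormD _ _) _.
  rewrite (splitr e); apply: ler_ltD; last exact: sT.
  apply: le_trans (rnorm_operator_le _ _) _.
  move: xz; rewrite ltr_pdivlMr // => /ltW; apply: le_trans.
  rewrite mulrC ler_wpM2l ?rnorm_ge0 //.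
  by apply: le_trans (AB _ AT) _; rewrite lerDl.
move=> [_ [[W oW <-] W0 WN]].
have /G0[[s e] /= e0 sW] : nbhs ((0 : 'L(E, F)) : {family compact, E -> F}) W.
  exact: open_nbhs_nbhs.
by exists s, e => // T AT Ts; apply: WN; apply: sW.
Qed.

Lemma tau_c_dual_neq A (f : dual 'L(E, F)) (d : R) :
  relatively_WOT_compact A -> @closure (WOT E F) A (0 : 'L(E, F)) -> 0 < d ->
  (forall T, convex_hull A T -> d <= re (f T)) ->
  ~ @continuous_functional R k (tau_c E F) f.
Proof.
move=> /WOT_compact_norm_bounded[B B0 AB] A0 d0 fd fc.
pose O : tau_c E F := (0 : 'L(E, F)).
(* Balls are convex, so the hull keeps the bound of [A] and [tau_c_small] applies to it. *)
have HB T : convex_hull A T -> rnorm T <= B.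
  apply: (convex_hull_min (C := [set T | rnorm T <= B])) T => // T U t TB UB t0 t1.
  apply: le_trans (rnormD _ _) _.
  have t10 : 0 <= 1 - t by rewrite subr_ge0.
  rewrite (@rnormZ R k 'L(E, F) t T) (@rnormZ R k 'L(E, F) (1 - t) U) !ger0_norm //.
  have := ler_wpM2l t0 TB; have := ler_wpM2l t10 UB; lra.
have fO : nbhs O [set T | `|re (f T)| < d].
  have : continuous_at O ((re : K^o -> R^o) \o (f : tau_c E F -> K^o)).
    by apply: continuous_comp; [exact: fc|exact: scalar_re_continuous].
  move=> /(@cvgrPdist_lt R R^o _ (nbhs O) (nbhs_filter O))/(_ _ d0).
  apply: (@filterS _ (nbhs O)) => T.
  by rewrite /= linear0 scalar_re0 sub0r normrN.
have [s [e e0 sN]] := tau_c_small B0 HB fO.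
have [T HT Ts] := hull_strongly_small s e0 A0.
have := sN T HT Ts; rewrite /= ltNge => /negP; apply.
exact: le_trans (fd _ HT) (ler_norm _).
Qed.

Lemma evaluation_functional (x : E) (y : dual F) :
  exists f : dual 'L(E, F), forall T, f T = y (T x).
Proof.
have bf : (fun T : 'L(E, F) => y (T x)) \in @bounded_linear K 'L(E, F) K^o.
  apply/asboolP; split; first by move=> a T U; rewrite -linearP.
  exists (inj (rnorm y * rnorm x)) => T.
  rewrite !rnormE -scalar_injM scalar_inj_le.
  apply: le_trans (rnorm_operator_le _ _) _; rewrite -mulrA.
  rewrite ler_wpM2l ?rnorm_ge0 // mulrC; exact: rnorm_operator_le.
by exists (BoundedOperator bf).
Qed.

(* [g] below is a Banach limit along the WOT-neighbourhoods of [0] in [A];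
   under reflexivity it is evaluation at an operator, which must be [0]. *)
Lemma not_reflexive_of_separation A (f : dual 'L(E, F)) (d : R) :
  relatively_WOT_compact A -> @closure (WOT E F) A (0 : 'L(E, F)) -> 0 < d ->
  (forall T, A T -> d <= re (f T)) ->
  ~ reflexive_space 'L(E, F).
Proof.
move=> /WOT_compact_norm_bounded[B B0 AB] A0 d0 fd refl.
pose O : WOT E F := (0 : 'L(E, F)).
(* Eventual upper bounds: [inf (L h)] is the upper limit of [re (h T)] as [T] in [A] tends to 0 in
   the WOT. *)
pose L (h : realified (dual 'L(E, F))) : set R :=
  [set b | \forall T \near O, A T -> re ((h : dual 'L(E, F)) T) <= b].
have hB (h : dual 'L(E, F)) T : A T -> `|re (h T)| <= B * rnorm h.
  move=> AT; apply: le_trans (normr_scalar_re _) _.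
  apply: le_trans (rnorm_operator_le h T) _.
  by rewrite mulrC ler_wpM2r ?rnorm_ge0 ?AB.
have LB h : L h (B * rnorm (h : dual 'L(E, F))).
  by apply: filterE => T AT; apply: le_trans (ler_norm _) _; exact: hB.
have Llb h : lbound (L h) (- (B * rnorm (h : dual 'L(E, F)))).
  (* Each WOT-neighbourhood of 0 meets [A], which bounds the upper limit from below. *)
  move=> b /A0[T [AT /(_ AT)]]; apply: le_trans.
  by have := hB h T AT; rewrite ler_norml => /andP[].
have sL : sublinear (fun h => inf (L h)).
  apply: sublinear_inf Llb _ _ => [h|h h' b c|a h b a0].
  - by exists (B * rnorm (h : dual 'L(E, F))).
  - apply: filterS2 => T hb hc AT.
    rewrite [re _]scalar_reD; apply: lerD; [exact: hb|exact: hc].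
  - apply: filterS => T hb AT.
    by rewrite [re _]scalar_reM ler_pM2l //; exact: hb.
have Lle h b : L h b -> inf (L h) <= b.
  by move=> Lb; apply: ge_inf Lb; exists (- (B * rnorm (h : dual 'L(E, F)))).
have [g [gD gZ gle]] := hahn_banach sL.
have [h|Phi [Phig _]] := @complexify R k (dual 'L(E, F)) g B B0 gD gZ.
  exact: le_trans (gle h) (Lle _ _ (LB h)).
have [T0 PhiT0] := refl Phi.
(* Test [T0 x] against a norming [y]: the functional sending [T] to [y (T x)] has upper limit at
   most every [e > 0]. *)
have T00 : T0 = 0.
  apply/val_inj/funext => x; apply: rnorm0_eq0; apply/eqP.
  rewrite eq_le rnorm_ge0 andbT; apply/ler_addgt0Pr => e e0; rewrite add0r.
  have [y [_ yT]] := norming_functional (T0 x); apply: le_trans yT _.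
  have [h hE] := evaluation_functional x y.
  rewrite -hE -PhiT0 Phig; apply: le_trans (gle h) _; apply: Lle.
  have := WOT_near0 x y e0; apply: filterS => T Te AT.
  by rewrite hE; apply: le_trans (ler_norm _) (ltW Te).
(* Upper limits bound [g] from above only, so the lower bound on [f] is used through [- f]. *)
have : re (Phi (- f)) <= - d.
  rewrite Phig; apply: le_trans (gle _) _; apply: Lle.
  apply: filterE => T AT.
  by rewrite [re _]scalar_reN lerN2 fd.
rewrite PhiT0 T00 linear0 scalar_re0; lra.
Qed.

End james.

Theorem proposition3p1 (R : realType) (k : scalar_kind)
    (E F : completeNormedModType (scalars R k)) :
  james_property E F ->
  norm_dual E F <> tau_c_dual E F /\ ~ reflexive_space 'L(E, F).
Proof.
move=> [A [cA A0 nA]].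
have [T0 [AT0 _]] := A0 setT filterT.
have [|f [d d0 fd]] := hull_separation _ nA; first by exists T0.
split; last first.
  by apply: not_reflexive_of_separation cA A0 d0 _ => T /convex_hull_sub; exact: fd.
move=> eq_dual; apply: (tau_c_dual_neq cA A0 d0 fd).
have : norm_dual E F f.
  (* Norm continuity of [f] follows from its boundedness on the unit ball around 0. *)
  apply: bounded_linear_continuous; apply/ex_bound; exists (operator_norm f).
  apply/nbhs_ballP; exists 1 => //= T; rewrite -ball_normE /ball_ /= sub0r normrN.
  move=> T1; apply: le_trans (le_operator_norm f T) _.
  by rewrite ler_piMr ?operator_norm_ge0 // ltW.
by rewrite eq_dual.
Qed.
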